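(* Let $H$ be a subgroup of the finite abelian group $G$, with $|H|=k$ and $|G/H|=m$. (1) The extended subgroup sum graph $\Gamma^+_{G,H}$ has $(m+s(G/H))/2$ connected components, of which $s(G/H)$ are complete graphs $K_k$ (whose vertex sets are the cosets of $H$ having order $1$ or $2$ in $G/H$), and $(m-s(G/H))/2$ are complete bipartite graphs $K_{k,k}$ (whose vertex sets are the unions of two cosets $H+a$ and $H-a$ for some $a\in G$ with $2a\notin H$). (2) The subgroup sum graph $\Gamma_{G,H}$ is obtained from the extended subgroup sum graph $\Gamma^+_{G,H}$ by deleting a perfect matching from every component which is complete bipartite, and deleting, from each complete component on a coset $H+a$, a matching covering all elements of the coset other than the elements of $S(G)$ lying in this coset (if any).
   Context: Groups are finite abelian, written additively with identity $0$. For a finite abelian group $G$ and a subgroup $H$, the extended subgroup sum graph $\Gamma^+_{G,H}$ is the simple graph with vertex set $G$ in which distinct $x,y$ are adjacent iff $x+y\in H$; the subgroup sum graph $\Gamma_{G,H}$ is the simple graph with vertex set $G$ in which distinct $x,y$ are adjacent iff $x+y\in H\setminus\{0\}$. For a finite abelian group $X$, $S(X)=\{x\in X: 2x=0\}$ and $s(X)=|S(X)|$. *)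

(* Defs.v *)
From HB Require Import structures.
From mathcomp Require Import all_boot all_order all_algebra all_fingroup all_solvable.

Set Implicit Arguments.
Unset Strict Implicit.
Unset Printing Implicit Defensive.

Import GRing.Theory.
Local Open Scope ring_scope.

Record sgraph (V : finType) := SGraph {
  adj :> rel V;
  adj_sym : symmetric adj;
  adj_irr : irreflexive adj }.

Section Graphs.
Variable V : finType.
Implicit Types (g : sgraph V) (A : {set V}) (M : {set {set V}}).

(* Connected components, given by their vertex sets. *)
Definition components g : {set {set V}} :=
  equivalence_partition (connect g) [set: V].

(* The subgraph of g induced on A is isomorphic to h. *)
Definition induced_iso g A (W : finType) (h : sgraph W) : bool :=
  [exists f : {ffun W -> V},
    [&& injectiveb f, f @: [set: W] == A
      & [forall u, forall v, g (f u) (f v) == h u v]]].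

Definition edges g : {set {set V}} :=
  [set [set p.1; p.2] | p : V * V & g p.1 p.2].

Definition matching_in g A M : bool :=
  [&& M \subset edges g, cover M \subset A & trivIset M].

Definition perfect_matching_in g A M : bool :=
  matching_in g A M && (cover M == A).

Definition delete_adj g M : rel V :=
  fun x y => g x y && ([set x; y] \notin M).

Lemma delete_adj_sym g M : symmetric (delete_adj g M).
Proof. by move=> x y; rewrite /delete_adj adj_sym setUC. Qed.

Lemma delete_adj_irr g M : irreflexive (delete_adj g M).
Proof. by move=> x; rewrite /delete_adj adj_irr. Qed.

Definition delete_edges g M : sgraph V :=
  SGraph (delete_adj_sym g M) (delete_adj_irr g M).

End Graphs.

Definition complete_adj n : rel 'I_n := fun i j => i != j.

Lemma complete_adj_sym n : symmetric (@complete_adj n).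
Proof. by move=> i j; rewrite /complete_adj eq_sym. Qed.

Lemma complete_adj_irr n : irreflexive (@complete_adj n).
Proof. by move=> i; rewrite /complete_adj eqxx. Qed.

Definition complete_graph n : sgraph 'I_n :=
  SGraph (@complete_adj_sym n) (@complete_adj_irr n).

Definition bipartite_adj p q : rel ('I_p + 'I_q)%type :=
  fun u v => match u, v with
             | inl _, inr _ | inr _, inl _ => true
             | _, _ => false
             end.

Lemma bipartite_adj_sym p q : symmetric (@bipartite_adj p q).
Proof. by case=> i [j|j]. Qed.

Lemma bipartite_adj_irr p q : irreflexive (@bipartite_adj p q).
Proof. by case. Qed.

Definition complete_bipartite_graph p q : sgraph ('I_p + 'I_q)%type :=
  SGraph (@bipartite_adj_sym p q) (@bipartite_adj_irr p q).

(* A finZmodType is also a finGroupType, for the group law x + y; the quotient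
   group by a subgroup H is therefore [set: G] / H and the coset H + a is
   (H :* a)%g. *)

(* S(X), the set of x in X with 2x = 0; X may be G itself or a quotient. *)
Definition two_torsion (gT : finGroupType) (X : {set gT}) : {set gT} := 'Ldiv_2(X)%g.

Section SumGraphs.
Variables (G : finZmodType) (H : {group G}).

Definition ext_sum_adj : rel G := fun x y => (x != y) && (x + y \in H).

Lemma ext_sum_adj_sym : symmetric ext_sum_adj.
Proof. by move=> x y; rewrite /ext_sum_adj eq_sym addrC. Qed.

Lemma ext_sum_adj_irr : irreflexive ext_sum_adj.
Proof. by move=> x; rewrite /ext_sum_adj eqxx. Qed.

Definition ext_sum_graph : sgraph G := SGraph ext_sum_adj_sym ext_sum_adj_irr.

Definition sum_adj : rel G :=
  fun x y => (x != y) && (x + y \in (H : {set G}) :\ 0).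

Lemma sum_adj_sym : symmetric sum_adj.
Proof. by move=> x y; rewrite /sum_adj eq_sym addrC. Qed.

Lemma sum_adj_irr : irreflexive sum_adj.
Proof. by move=> x; rewrite /sum_adj eqxx. Qed.

Definition sum_graph : sgraph G := SGraph sum_adj_sym sum_adj_irr.

End SumGraphs.

(* Main.v *)
Require Import Defs.
From HB Require Import structures.
From mathcomp Require Import all_boot all_order all_algebra all_fingroup all_solvable.
From mathcomp Require Import ring.

(** Modulo [H], adjacency of distinct vertices means that their classes are
    opposite.  So the component of [a] in the extended graph is the union
    [pm_coset a] of the cosets of [a] and [- a] ([connect_ext_sum]).  If
    [2a] lies in [H] the two cosets coincide and any two of their elements sum
    into [H], which gives a complete graph on [#|H|] vertices
    ([pm_coset_complete]); otherwise they are disjoint, no edge joins two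
    elements of the same coset and all edges run between the two
    ([pm_coset_bipartite]).  The two kinds are told apart by their numbers of
    vertices, [#|H|] and [2 * #|H|].

    The complete components are in bijection with the elements of [G / H]
    killed by 2, that is [s] in number; if [t] is the number of bipartite ones,
    counting the vertices of the partition of [G] into components gives
    [#|G / H| = s + 2 * t], from which both counts follow.

    Passing to the subgroup sum graph removes the edges [{x, y}] with
    [x + y = 0], i.e. the pairs [{x, - x}] with [2x != 0].  Each component is
    stable under negation, so these pairs form in it a matching
    ([opp_pairs_matching]) that misses exactly the elements of [S(G)]; there
    are none of these in a bipartite component, where the matching is thus
    perfect. *)

Set Implicit Arguments.
Unset Strict Implicit.
Unset Printing Implicit Defensive.

Import GRing.Theory.
Local Open Scope ring_scope.

(** * Recognising complete and complete bipartite induced subgraphs *)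

Section InducedSubgraphs.
Variable V : finType.
Implicit Types (g : sgraph V) (A B C : {set V}).

Lemma card_induced_iso g A (W : finType) (h : sgraph W) :
  induced_iso g A h -> #|A| = #|W|.
Proof.
case/existsP=> f /and3P[/injectiveP f_inj /eqP <- _].
by rewrite card_imset // cardsT.
Qed.

Lemma complete_induced_iso g A :
  {in A &, forall x y, g x y = (x != y)} ->
  induced_iso g A (complete_graph #|A|).
Proof.
move=> gA; apply/existsP; exists [ffun i => enum_val i].
have f_inj : injective [ffun i : 'I_#|A| => enum_val i].
  by move=> i j; rewrite !ffunE; apply: enum_val_inj.
apply/and3P; split; first exact/injectiveP.
- rewrite eqEcard card_imset // cardsT card_ord leqnn andbT.
  by apply/subsetP=> _ /imsetP[i _ ->]; rewrite ffunE enum_valP.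
apply/forallP=> i; apply/forallP=> j; rewrite !ffunE gA ?enum_valP //.
by rewrite (inj_eq enum_val_inj).
Qed.

Lemma bipartite_induced_iso g p q B C :
  #|B| = p -> #|C| = q -> [disjoint B & C] ->
  {in B &, forall x y, g x y = false} -> {in C &, forall x y, g x y = false} ->
  {in B & C, forall x y, g x y} ->
  induced_iso g (B :|: C) (complete_bipartite_graph p q).
Proof.
move=> <- <- dBC gB gC gBC; apply/existsP.
pose f (u : 'I_#|B| + 'I_#|C|) : V :=
  match u with inl i => enum_val i | inr j => enum_val j end.
have f_inj : injective (finfun f).
  move=> [i|i] [j|j]; rewrite !ffunE /= => eq_f.
  - by rewrite (enum_val_inj eq_f).
  - by have := enum_valP j; rewrite -eq_f (disjointFr dBC) ?enum_valP.
  - by have := enum_valP i; rewrite eq_f (disjointFr dBC) ?enum_valP.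
  - by rewrite (enum_val_inj eq_f).
exists (finfun f); apply/and3P; split; first exact/injectiveP.
- rewrite eqEcard card_imset // cardsT card_sum !card_ord.
  rewrite cardsU disjoint_setI0 // cards0 subn0 leqnn andbT.
  apply/subsetP=> _ /imsetP[[i|i] _ ->]; rewrite ffunE inE /= enum_valP //.
  by rewrite orbT.
apply/forallP=> -[i|i]; apply/forallP=> -[j|j]; rewrite !ffunE /=.
- by rewrite gB ?enum_valP.
- by rewrite gBC ?enum_valP.
- by rewrite adj_sym gBC ?enum_valP.
- by rewrite gC ?enum_valP.
Qed.

End InducedSubgraphs.

Section ExtendedSumGraph.
Variables (G : finZmodType) (H : {group G}).
Implicit Types (a u v x y z : G) (A : {set G}).

(** * Subgroup and coset membership in additive notation *)

Lemma mem0_group : (0 : G) \in H. Proof. exact: (group1 H). Qed.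

Lemma memN_group x : (- x \in H) = (x \in H).
Proof. exact: groupV. Qed.

Lemma memD_groupl x y : x \in H -> (x + y \in H) = (y \in H).
Proof. exact: groupMl. Qed.

Lemma memD_group_eq x y : x + y \in H -> (x \in H) = (y \in H).
Proof.
move=> xyH; have -> : x = (x + y) + - y by rewrite addrK.
by rewrite memD_groupl // memN_group.
Qed.

Lemma mem_rcosetD x y : (y \in (H :* x)%g) = (y - x \in H).
Proof. by rewrite mem_rcoset. Qed.

Lemma rcosetD_sum a x y :
  x \in (H :* a)%g -> y \in (H :* a)%g -> (x + y \in H) = (a + a \in H).
Proof.
rewrite !mem_rcosetD => xH yH.
have -> : x + y = (x - a) + (y - a) + (a + a).
  by rewrite [x - a + _]addrACA -opprD subrK.
by rewrite -addrA (memD_groupl _ xH) (memD_groupl _ yH).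
Qed.

(** * Components of the extended graph *)

(** The union of the coset of [a] and of its opposite; the two may coincide. *)
Definition pm_coset a : {set G} := (H :* a)%g :|: (H :* (- a)%R)%g.

Lemma mem_pm_coset a x : (x \in pm_coset a) = (x - a \in H) || (x + a \in H).
Proof. by rewrite inE !mem_rcosetD opprK. Qed.

Lemma mem_pm_cosetN a x : (- x \in pm_coset a) = (x \in pm_coset a).
Proof.
rewrite !mem_pm_coset orbC -(memN_group (- x + a)) -(memN_group (- x - a)).
by rewrite !opprD !opprK.
Qed.

Lemma connect_ext_sum x y :
  connect (ext_sum_graph H) x y = (y \in pm_coset x).
Proof.
have step u v : u + v \in H -> connect (ext_sum_graph H) u v.
  move=> uvH; have [-> | nuv] := eqVneq u v; first exact: connect0.
  by apply: connect1; rewrite /= /ext_sum_adj nuv.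
apply/idP/idP=> [cxy|]; last first.
  rewrite mem_pm_coset => /orP[yxH | yxH]; last by apply: step; rewrite addrC.
  (* both x and y are adjacent, or equal, to - x *)
  apply: (@connect_trans _ _ (- x)); apply: step.
    by rewrite subrr mem0_group.
  by rewrite addrC.
have clos : closed (ext_sum_graph H) (mem (pm_coset x)).
  move=> u v /andP[_ uvH]; rewrite !mem_pm_coset orbC.
  (* both (u + x) + (v - x) and (u - x) + (v + x) are u + v *)
  rewrite (@memD_group_eq (u + x) (v - x)) ?(@memD_group_eq (u - x) (v + x)) //.
    by rewrite addrACA addNr addr0.
  by rewrite addrACA subrr addr0.
by rewrite -(closed_connect clos cxy) mem_pm_coset subrr mem0_group.
Qed.

Lemma connect_ext_sum_equiv :
  {in [set: G] & &, equivalence_rel (connect (ext_sum_graph H))}.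
Proof.
move=> x y z _ _ _; split=> [|cxy]; first exact: connect0.
by apply: (same_connect (sym_connect_sym (@adj_sym _ (ext_sum_graph H))) cxy).
Qed.

Lemma components_ext_sum :
  components (ext_sum_graph H) = [set pm_coset x | x : G].
Proof.
apply/setP=> A; apply/imsetP/imsetP=> -[x _ ->]; exists x => //; apply/setP=> y.
  by rewrite inE in_setT connect_ext_sum.
by rewrite inE in_setT connect_ext_sum.
Qed.

Lemma components_ext_sum_partition :
  partition (components (ext_sum_graph H)) [set: G].
Proof. exact/equivalence_partitionP/connect_ext_sum_equiv. Qed.

Lemma pm_coset_id a : a + a \in H -> pm_coset a = (H :* a)%g.
Proof.
move=> aH; apply/setP=> x; rewrite mem_pm_coset mem_rcosetD.
suff -> : (x + a \in H) = (x - a \in H) by rewrite orbb.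
have -> : x + a = (a + a) + (x - a) by rewrite [RHS]addrC addrA subrK.
exact: memD_groupl.
Qed.

Lemma pm_coset_disjoint a :
  a + a \notin H -> [disjoint (H :* a)%g & (H :* (- a)%R)%g].
Proof.
move=> aH; apply/pred0P=> x /=; rewrite !mem_rcosetD opprK.
apply: contraNF aH => /andP[xH].
have -> : x + a = (x - a) + (a + a) by rewrite addrA subrK.
by rewrite (memD_groupl _ xH).
Qed.

Lemma card_pm_coset_id a : a + a \in H -> #|pm_coset a| = #|H|.
Proof. by move=> aH; rewrite pm_coset_id // card_rcoset. Qed.

Lemma card_pm_coset_disjoint a : a + a \notin H -> #|pm_coset a| = (2 * #|H|)%N.
Proof.
move=> aH; rewrite cardsU disjoint_setI0 ?pm_coset_disjoint //.
by rewrite cards0 subn0 !card_rcoset addnn mul2n.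
Qed.

Lemma pm_coset_complete a : a + a \in H ->
  induced_iso (ext_sum_graph H) (pm_coset a) (complete_graph #|H|).
Proof.
move=> aH; rewrite -(card_pm_coset_id aH); apply: complete_induced_iso.
rewrite pm_coset_id // => x y xa ya.
by rewrite /= /ext_sum_adj (rcosetD_sum xa ya) aH andbT.
Qed.

Lemma pm_coset_bipartite a : a + a \notin H ->
  induced_iso (ext_sum_graph H) (pm_coset a)
    (complete_bipartite_graph #|H| #|H|).
Proof.
move=> aH; apply: bipartite_induced_iso; rewrite ?card_rcoset //.
- exact: pm_coset_disjoint.
- move=> x y xa ya; rewrite /= /ext_sum_adj (rcosetD_sum xa ya).
  by rewrite (negPf aH) andbF.
- move=> x y xa ya; rewrite /= /ext_sum_adj (rcosetD_sum xa ya).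
  by rewrite -opprD memN_group (negPf aH) andbF.
move=> x y xa ya; rewrite /= /ext_sum_adj; apply/andP; split.
  by apply: contraTneq ya => <-; rewrite (disjointFr (pm_coset_disjoint aH)).
rewrite !mem_rcosetD opprK in xa ya.
have -> : x + y = (x - a) + (y + a) by rewrite addrACA addNr addr0.
by rewrite (memD_groupl _ xa).
Qed.

(** The converse direction compares the numbers of vertices. *)
Lemma pm_coset_completeE a :
  induced_iso (ext_sum_graph H) (pm_coset a) (complete_graph #|H|)
    = (a + a \in H).
Proof.
apply/idP/idP=> [/card_induced_iso|]; last exact: pm_coset_complete.
rewrite card_ord; case: (boolP (_ \in _)) => // aH.
rewrite card_pm_coset_disjoint // => /eqP.
by rewrite mul2n -addnn -{3}[#|H|]addn0 eqn_add2l (gtn_eqF (cardG_gt0 H)).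
Qed.

Lemma pm_coset_bipartiteE a :
  induced_iso (ext_sum_graph H) (pm_coset a)
    (complete_bipartite_graph #|H| #|H|) = (a + a \notin H).
Proof.
apply/idP/idP=> [/card_induced_iso|]; last exact: pm_coset_bipartite.
rewrite card_sum card_ord; case: (boolP (_ \in _)) => // aH.
rewrite card_pm_coset_id // => /esym/eqP.
by rewrite -{3}[#|H|]addn0 eqn_add2l (gtn_eqF (cardG_gt0 H)).
Qed.

Lemma complete_components :
  [set A in components (ext_sum_graph H)
     | induced_iso (ext_sum_graph H) A (complete_graph #|H|)]
  = [set pm_coset a | a : G & a + a \in H].
Proof.
rewrite components_ext_sum; apply/setP=> A; rewrite inE.
apply/andP/imsetP=> [[/imsetP[a _ ->]]|[a]].
  by rewrite pm_coset_completeE => aH; exists a; rewrite ?inE.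
by rewrite inE => aH ->; rewrite pm_coset_completeE imset_f.
Qed.

Lemma bipartite_components :
  [set A in components (ext_sum_graph H)
     | induced_iso (ext_sum_graph H) A (complete_bipartite_graph #|H| #|H|)]
  = [set pm_coset a | a : G & a + a \notin H].
Proof.
rewrite components_ext_sum; apply/setP=> A; rewrite inE.
apply/andP/imsetP=> [[/imsetP[a _ ->]]|[a]].
  by rewrite pm_coset_bipartiteE => aH; exists a; rewrite ?inE.
by rewrite inE => aH ->; rewrite pm_coset_bipartiteE imset_f.
Qed.

(** * The quotient and the number of components *)

Lemma norm_zmod a : a \in 'N(H)%g.
Proof.
have abG := FinRing.zmod_abelian [set: G].
by rewrite (subsetP (sub_abelian_norm abG (subsetT H))) ?inE.
Qed.

Lemma coset_expg2_eq1 a : ((coset H a ^+ 2)%g == 1%g) = (a + a \in H).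
Proof.
rewrite -morphX ?norm_zmod //; apply/eqP/idP => [/coset_idr|].
  by rewrite norm_zmod; apply.
by move/coset_id.
Qed.

Lemma set_of_cosetE a : set_of_coset (coset H a) = (H :* a)%g.
Proof. exact/val_coset/norm_zmod. Qed.

(** When [2a] lies in [H], the component of [a] is the single coset of [a],
    so these components are the elements of [G / H] killed by 2, seen as
    subsets of [G]. *)
Lemma complete_components_torsion :
  [set pm_coset a | a : G & a + a \in H]
  = [set set_of_coset X | X in two_torsion ([set: G] / H)%g].
Proof.
apply/setP=> A; apply/imsetP/imsetP=> [[a]|[X]].
  rewrite inE => aH ->; exists (coset H a); last first.
    by rewrite set_of_cosetE pm_coset_id.
  apply/LdivP; split; first by rewrite mem_quotient ?inE.
  by apply/eqP; rewrite coset_expg2_eq1.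
case/LdivP=> _ /eqP X2 ->; exists (repr X).
  by rewrite inE -coset_expg2_eq1 coset_reprK.
rewrite pm_coset_id -?set_of_cosetE ?coset_reprK //.
by rewrite -coset_expg2_eq1 coset_reprK.
Qed.

Lemma two_torsionE (gT : finGroupType) (X : {set gT}) :
  two_torsion X = [set x in X | (#[x]%g == 1%N) || (#[x]%g == 2%N)].
Proof.
apply/setP=> x; rewrite !inE; congr (_ && _).
rewrite -order_dvdn; have := order_gt0 x.
by case: #[x]%g => [|[|[|n]]] //= _; rewrite gtnNdvd.
Qed.

Lemma card_complete_components :
  #|[set pm_coset a | a : G & a + a \in H]| = #|two_torsion ([set: G] / H)%g|.
Proof.
rewrite complete_components_torsion card_imset //.
exact: val_inj.
Qed.

Lemma components_split :
  components (ext_sum_graph H) =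
    [set pm_coset a | a : G & a + a \in H]
    :|: [set pm_coset a | a : G & a + a \notin H].
Proof.
rewrite components_ext_sum -imsetU.
apply/setP=> A; apply/imsetP/imsetP=> -[a _ ->]; exists a => //.
by rewrite !inE orbN.
Qed.

Lemma components_split_disjoint :
  [disjoint [set pm_coset a | a : G & a + a \in H]
     & [set pm_coset a | a : G & a + a \notin H]].
Proof.
apply/pred0P=> A /=; apply/negbTE/negP=> /andP[/imsetP[a aH ->] /imsetP[b bH]].
rewrite !inE in aH bH => eq_ab.
by move: bH; rewrite -pm_coset_completeE -eq_ab pm_coset_completeE aH.
Qed.

Lemma card_components :
  #|components (ext_sum_graph H)| =
    (#|two_torsion ([set: G] / H)%g|
     + #|[set pm_coset a | a : G & (a + a)%R \notin H]|)%N.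
Proof.
rewrite components_split cardsU disjoint_setI0 ?components_split_disjoint //.
by rewrite cards0 subn0 card_complete_components.
Qed.

(** The quotient group has one element for each complete component and two,
    which are opposite, for each bipartite one. *)
Lemma card_quotient_components :
  #|([set: G] / H)%g| =
    (#|two_torsion ([set: G] / H)%g|
     + 2 * #|[set pm_coset a | a : G & (a + a)%R \notin H]|)%N.
Proof.
apply/eqP; rewrite -(eqn_pmul2l (cardG_gt0 H)); apply/eqP.
rewrite card_quotient; last by apply/subsetP=> a _; apply: norm_zmod.
(* count the vertices of G by cosets, then by components *)
rewrite Lagrange ?subsetT // (card_partition components_ext_sum_partition).
rewrite components_split.
set K := [set pm_coset a | a : G & a + a \in H].
set L := [set pm_coset a | a : G & a + a \notin H].
have dKL : [disjoint K & L] by apply: components_split_disjoint.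
rewrite (eq_bigl [in [predU K & L]]) => [|A]; last by rewrite !inE.
rewrite bigU //=.
rewrite (eq_bigr (fun=> #|H|)); last first.
  by move=> _ /imsetP[a aH ->]; rewrite inE in aH; rewrite card_pm_coset_id.
rewrite sum_nat_const card_complete_components.
rewrite (eq_bigr (fun=> (2 * #|H|)%N)); last first.
  move=> _ /imsetP[a aH ->]; rewrite inE in aH.
  exact: card_pm_coset_disjoint.
rewrite sum_nat_const mulnDr; congr (_ + _)%N; first exact: mulnC.
by rewrite mulnA [RHS]mulnC (mulnC 2).
Qed.

(** * The deleted matchings *)

(** The pairs [{x, - x}] of distinct opposite elements of [A]. *)
Definition opp_pairs A : {set {set G}} :=
  [set [set x; - x] | x in A & x != - x].

Lemma mem_two_torsionT x : (x \in two_torsion [set: G]) = (x == - x).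
Proof. by rewrite !inE /= -addr_eq0. Qed.

Lemma cover_opp_pairs A : {in A, forall x, - x \in A} ->
  cover (opp_pairs A) = A :\: two_torsion [set: G].
Proof.
move=> AN; apply/setP=> y; rewrite inE mem_two_torsionT.
apply/bigcupP/andP=> [[B /imsetP[x + ->]]|[yN yA]]; last first.
  exists [set y; - y]; last exact: set21.
  by apply/imsetP; exists y; rewrite // inE yA.
rewrite inE => /andP[xA xN] /set2P[]-> //.
by rewrite opprK eq_sym xN AN.
Qed.

Lemma opp_pairs_matching A : {in A, forall x, - x \in A} ->
  matching_in (ext_sum_graph H) A (opp_pairs A).
Proof.
move=> AN; apply/and3P; split.
- apply/subsetP=> B /imsetP[x + ->]; rewrite inE => /andP[_ xN].
  apply/imsetP; exists (x, - x) => //.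
  by rewrite inE /= /ext_sum_adj xN subrr mem0_group.
- by rewrite cover_opp_pairs // subsetDl.
apply/trivIsetP=> _ _ /imsetP[x _ ->] /imsetP[y _ ->].
apply: contraR => /pred0Pn[z /andP[/= /set2P zx /set2P zy]].
(* a pair is determined by either of its elements *)
have pairE w : z = w \/ z = - w -> [set w; - w] = [set z; - z].
  by case=> ->; rewrite // opprK setUC.
by rewrite (pairE x) // (pairE y).
Qed.

Lemma mem_component_opp A :
  A \in components (ext_sum_graph H) -> {in A, forall x, - x \in A}.
Proof.
by rewrite components_ext_sum => /imsetP[a _ ->] x; rewrite mem_pm_cosetN.
Qed.

Lemma cover_opp_pairs_bipartite A :
  A \in [set pm_coset a | a : G & a + a \notin H] -> cover (opp_pairs A) = A.
Proof.
case/imsetP=> a; rewrite inE => aH ->.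
rewrite cover_opp_pairs => [|x]; last by rewrite mem_pm_cosetN.
apply/setDidPl/pred0P=> x /=; rewrite mem_two_torsionT -addr_eq0.
apply: contraNF aH => /andP[+ /eqP x2].
rewrite inE => /orP[] xa; have := rcosetD_sum xa xa; rewrite x2 mem0_group //.
by rewrite -opprD memN_group => <-.
Qed.

Lemma sum_graph_delete :
  sum_graph H =2 delete_edges (ext_sum_graph H)
    (\bigcup_(A in components (ext_sum_graph H)) opp_pairs A).
Proof.
move=> x y; rewrite /= /sum_adj /delete_adj /= /ext_sum_adj !inE -andbA.
case: eqVneq => //= nxy; rewrite andbC; case: (x + y \in H) => //=.
congr (~~ _); rewrite addr_eq0.
apply/eqP/bigcupP=> [xNy|[A _ /imsetP[z _ xyz]]].
  exists (pm_coset x); first by rewrite components_ext_sum imset_f.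
  apply/imsetP; exists x; last by rewrite xNy opprK.
  rewrite inE mem_pm_coset subrr mem0_group /=.
  by rewrite {2}xNy opprK.
have /set2P[] : x \in [set z; - z] by rewrite -xyz set21.
  have /set2P[] : y \in [set z; - z] by rewrite -xyz set22.
    by move=> yz xz; rewrite yz xz eqxx in nxy.
  by move=> -> ->; rewrite opprK.
have /set2P[] : y \in [set z; - z] by rewrite -xyz set22.
  by move=> -> ->.
by move=> yz xz; rewrite yz xz eqxx in nxy.
Qed.

End ExtendedSumGraph.

Theorem theorem3p2 (G : finZmodType) (H : {group G}) (k m : nat)
    (hk : #|H| = k) (hm : #|([set: G] / H)%g| = m) :
  let s := #|two_torsion ([set: G] / H)%g| in
  let Gamma := sum_graph H in
  let Gammap := ext_sum_graph H in
  let comps := components Gammap in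
  let Kk := [set A in comps | induced_iso Gammap A (complete_graph k)] in
  let Kkk :=
    [set A in comps | induced_iso Gammap A (complete_bipartite_graph k k)] in
  [/\ #|comps|%:R = (m%:R + s%:R) / 2 :> rat,
      #|Kk| = s,
      Kk = [set set_of_coset X | X in ([set: G] / H)%g
                               & (#[X]%g == 1%N) || (#[X]%g == 2%N)],
      #|Kkk|%:R = (m%:R - s%:R) / 2 :> rat
    & Kkk = [set (H :* a)%g :|: (H :* (- a)%R)%g | a : G & a *+ 2 \notin H]]
  /\
  exists M : {set G} -> {set {set G}},
    [/\ forall A, A \in comps -> matching_in Gammap A (M A),
        forall A, A \in Kkk -> perfect_matching_in Gammap A (M A),
        forall A, A \in Kk -> cover (M A) = A :\: two_torsion [set: G]
      & Gamma =2 delete_edges Gammap (\bigcup_(A in comps) M A)].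
Proof.
move=> s Gamma Gammap comps Kk Kkk; subst k m.
have KkE : Kk = [set pm_coset H a | a : G & a + a \in H].
  exact: complete_components.
have KkkE : Kkk = [set pm_coset H a | a : G & a + a \notin H].
  exact: bipartite_components.
have mE := card_quotient_components H; rewrite -KkkE -/s in mE.
have cE := card_components H; rewrite -KkkE -/s -/Gammap -/comps in cE.
split; first split.
- by rewrite cE mE mul2n -addnn !natrD; field.
- by rewrite KkE card_complete_components.
- by rewrite KkE complete_components_torsion two_torsionE.
- by rewrite mE mul2n -addnn !natrD; field.
- by rewrite KkkE; apply: eq_imset.
exists (@opp_pairs G); split=> [A Ac|A|A|].
- exact: opp_pairs_matching (mem_component_opp Ac).
- move=> AK; have Ac : A \in comps by case/setIdP: AK.
  rewrite /perfect_matching_in opp_pairs_matching;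
    last exact: mem_component_opp Ac.
  by rewrite (cover_opp_pairs_bipartite (H := H)) ?eqxx // -KkkE.
- by case/setIdP=> Ac _; apply: cover_opp_pairs (mem_component_opp Ac).
- exact: sum_graph_delete.
Qed.
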